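(* Let $\Gamma$ be a discrete group with identity element $e$, let $f \in \ell^1(\Gamma)$, and let $\rho_f : \ell^\infty(\Gamma) \to \ell^\infty(\Gamma)$ be the convolution operator defined by $$\rho_f(g)(x) = \sum_{y \in \Gamma} g(xy) f(y) \qquad (g \in \ell^\infty(\Gamma),\ x \in \Gamma).$$ Then the following are equivalent: (1) $\rho_f$ is injective; (2) $\rho_f$ is bijective; (3) $f$ is invertible in $\ell^1(\Gamma)$, i.e. there exists $g \in \ell^1(\Gamma)$ such that $f * g = \delta_e = g * f$.
   Context: $\Gamma$ is an arbitrary discrete group (not assumed countable). $\ell^1(\Gamma)$ is the Banach space of absolutely summable functions $\Gamma \to \mathbb{C}$, regarded as a unital Banach algebra under convolution $(h*f)(z) = \sum_{y \in \Gamma} h(zy^{-1}) f(y)$, with unit $\delta_e$ (the indicator function of $\{e\}$). $\ell^\infty(\Gamma)$ is the Banach space of all bounded functions $\Gamma \to \mathbb{C}$ with the supremum norm. *)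

(* Defs.v *)
From HB Require Import structures.
From mathcomp Require Import all_boot all_order all_algebra.
From mathcomp Require Import all_classical all_reals all_analysis.
From mathcomp Require Import complex.
From mathcomp Require summability.
Set Implicit Arguments.
Unset Strict Implicit.
Unset Printing Implicit Defensive.
Import Order.TTheory GRing.Theory Num.Theory numFieldNormedType.Exports.

Local Open Scope classical_set_scope.
Local Open Scope complex_scope.
Local Open Scope ring_scope.

(* The modulus topology on the complex numbers, transported from [R[i]^o]. *)
HB.instance Definition _ (R : realType) := NormedModule.copy R[i] R[i]^o.

Section GroupConvolution.
Variables (R : realType) (G : groupType).
Implicit Types f g h : G -> R[i].

Definition l1 : set (G -> R[i]) :=
  [set f | summable setT (fun x => (Normc.normc (f x))%:E)].

Definition linfty : set (G -> R[i]) := [set g | bounded_fun g].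

(* [summability.sum] is the limit of the finite partial sums along the
   directed set of finite subsets of G (unconditional summation, so G need
   not be countable); being a total [lim], it is meaningful when the family
   is summable, e.g. for h, f in l1 here and g in linfty, f in l1 below. *)
Definition convolution h f : G -> R[i] :=
  fun z => summability.sum (fun y => h (z * y^-1)%g * f y).

Definition rho f g : G -> R[i] :=
  fun x => summability.sum (fun y => g (x * y)%g * f y).

Definition delta_e : G -> R[i] := \1_[set 1%g].

End GroupConvolution.

Arguments linfty R G : clear implicits.
Arguments delta_e R G : clear implicits.

(* Main.v *)
(** The operator rho_f is the transpose of h |-> h * f on l1.  If it is injective,
    Hahn-Banach makes the left ideal l1 * f dense, so some h * f is within 1/2
    of delta_e and a Neumann series makes f left invertible, say h * f = delta_e.
    It remains to see that l1 is directly finite.  The idempotent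
    q = delta_e - f * h satisfies q(e) = 0, because (f * h)(e) = (h * f)(e).
    Following Kaplansky and Passman, let a nearly minimise |delta_e - v|_2 over
    the v in l1 with q * v = v.  Near-orthogonality makes a nearly self-adjoint
    and gives <v, a> ~ v(e) for all such v.  Hence a(e) = (q * a)(e) ~ <q, a> ~ q(e) = 0
    and |a|_2^2 ~ a(e), so a ~ 0; applied to the right translates of q, this
    gives q = 0.  Conversely, rho_f rho_g = rho_(f * g). *)

Require Import Defs.
From mathcomp Require Import all_boot all_order all_algebra finmap.
From mathcomp Require Import all_classical all_reals all_analysis.
From mathcomp Require Import complex.
From mathcomp Require summability.
From mathcomp Require Import ring lra.
Set Implicit Arguments.
Unset Strict Implicit.
Unset Printing Implicit Defensive.
Import Order.TTheory GRing.Theory Num.Theory numFieldNormedType.Exports.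
Import mathcomp.real_closed.complex Normc.

Local Open Scope classical_set_scope.
Local Open Scope complex_scope.
Local Open Scope ring_scope.

(** * Unconditional sums *)

Section Modulus.
Variable R : realType.
Implicit Types (x y : R[i]) (a : R).

Lemma normr_normc x : `|x| = (normc x)%:C.
Proof. by case: x. Qed.

Lemma normc_ge0 x : 0 <= normc x.
Proof. by case: x => a b; exact: sqrtr_ge0. Qed.

Lemma normcD x y : normc (x + y) <= normc x + normc y.
Proof. exact: le_normcD. Qed.

Lemma normc_opp x : normc (- x) = normc x.
Proof. exact: normcN. Qed.

Lemma normcB x y : normc (x - y) <= normc x + normc y.
Proof. by rewrite -(normc_opp y) normcD. Qed.

Lemma normcR a : normc a%:C = `|a|.
Proof. by rewrite /= expr0n addr0 sqrtr_sqr. Qed.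

Lemma normc_conj x : normc (x^*)%C = normc x.
Proof. by case: x => a b; rewrite /= sqrrN. Qed.

Lemma mulc_conj x : x * (x^*)%C = (normc x)%:C ^+ 2.
Proof.
rewrite -rmorphXn/=; case: x => a b /=; rewrite sqr_sqrtr ?addr_ge0 ?sqr_ge0//.
by apply/eqP; rewrite eq_complex /=; apply/andP; split; apply/eqP; ring.
Qed.

Lemma ler_normc_sum (I : Type) (s : seq I) (f : I -> R[i]) :
  normc (\sum_(i <- s) f i) <= \sum_(i <- s) normc (f i).
Proof.
elim/big_ind2 : _ => [|x a y b xa yb|//]; first by rewrite normc0.
by apply: le_trans (normcD _ _) _; exact: lerD.
Qed.

End Modulus.

Section Summation.
Variables (R : realType) (I : choiceType).
Implicit Types (f g : I -> R[i]) (A B : {fset I}) (s t : R[i]).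

Definition csum f : R[i] := summability.sum f.

Definition abs_bounded f (M : R) := forall A, \sum_(i <- A) normc (f i) <= M.

Definition abs_summable f := exists M, abs_bounded f M.

(* [sup] of an unbounded set is [0], so [norm1 f] is only meaningful for summable [f]. *)
Definition norm1 f : R :=
  sup [set \sum_(i <- A) normc (f i) | A in [set: {fset I}]].

(** Convergence along finite subsets, phrased with a real [e] and the real modulus so that all
    estimates stay in [R] rather than in the partial order of [R[i]]. *)
Definition has_sum f s := forall e : R, 0 < e -> exists A,
  forall B, (A `<=` B)%fset -> normc (s - \sum_(i <- B) f i) < e.

Lemma abs_summable_has_sup f : abs_summable f ->
  has_sup [set \sum_(i <- A) normc (f i) | A in [set: {fset I}]].
Proof.
move=> [M fM]; split; first by exists (\sum_(i <- fset0) normc (f i)), fset0.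
by exists M => _ [A _ <-]; exact: fM.
Qed.

Lemma norm1_ub f A : abs_summable f -> \sum_(i <- A) normc (f i) <= norm1 f.
Proof.
by move=> fs; apply: sup_upper_bound; [exact: abs_summable_has_sup|exists A].
Qed.

Lemma abs_bounded_norm1 f : abs_summable f -> abs_bounded f (norm1 f).
Proof. by move=> fs A; exact: norm1_ub. Qed.

Lemma norm1_le f M : abs_bounded f M -> norm1 f <= M.
Proof.
move=> fM; apply: ge_sup => [|_ [A _ <-]]; last exact: fM.
by exists (\sum_(i <- fset0) normc (f i)), fset0.
Qed.

Lemma norm1_ge0 f : abs_summable f -> 0 <= norm1 f.
Proof. by move=> /(@norm1_ub _ fset0); rewrite big_seq_fset0. Qed.

Lemma normc_le_norm1 f i : abs_summable f -> normc (f i) <= norm1 f.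
Proof. by move=> /(@norm1_ub _ [fset i]%fset); rewrite big_seq_fset1. Qed.

Lemma ler_sum_fset (u : I -> R) A B : (forall i, 0 <= u i) -> (A `<=` B)%fset ->
  \sum_(i <- A) u i <= \sum_(i <- B) u i.
Proof.
move=> u0 AB; rewrite [leRHS](big_fsetID _ (mem A))/=.
have -> : [fset i in B | i \in A]%fset = A.
  apply/fsetP => i; rewrite !inE/=; case: (boolP (i \in A)) => iA; last by rewrite andbF.
  by rewrite andbT (fsubsetP AB).
by rewrite lerDl sumr_ge0.
Qed.

Lemma norm1_adherent f (e : R) : abs_summable f -> 0 < e ->
  exists A, norm1 f - e < \sum_(i <- A) normc (f i).
Proof.
move=> /abs_summable_has_sup sf e0.
by have [_ [A _ <-] ?] := sup_adherent e0 sf; exists A.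
Qed.

Lemma has_sum_csum f s : has_sum f s -> csum f = s.
Proof.
rewrite /csum => fs; have totallyF := @summability.totally_filter I.
apply: cvg_lim; first exact: norm_hausdorff.
apply/cvgrPdist_lt => e e0.
(* In the order of [R[i]], being positive forces a zero imaginary part. *)
have [e' e'0 ->] : exists2 e', 0 < e' & e = e'%:C.
  by case: e e0 => a b; rewrite ltcE/= => /andP[/eqP -> a0]; exists a.
have [A sA] := fs _ e'0; exists A => // B /sA; rewrite -ltcR -normr_normc.
by rewrite /summability.partial_sum -(big_seq_fsetE _ B xpredT).
Qed.

Lemma has_sum0 : has_sum (fun=> 0) 0.
Proof. by move=> e e0; exists fset0 => B _; rewrite big1// subr0 normc0. Qed.

Lemma has_sumD f g s t : has_sum f s -> has_sum g t -> has_sum (f + g) (s + t).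
Proof.
move=> fs gt e e0; have e2 : 0 < e / 2 by lra.
have [A sA] := fs _ e2; have [B tB] := gt _ e2.
exists (A `|` B)%fset => C; rewrite fsubUset => /andP[/sA AC /tB BC].
rewrite big_split/= opprD addrACA; apply: le_lt_trans (normcD _ _) _; lra.
Qed.

Lemma has_sumZ c f s : has_sum f s -> has_sum (c *: f) (c * s).
Proof.
move=> fs e e0; have c0 := normc_ge0 c.
(* The [+ 1] covers [c = 0]. *)
have [|A sA] := fs (e / (normc c + 1)); first by rewrite divr_gt0//; lra.
exists A => B /sA; rewrite -mulr_sumr -mulrBr normcM ltr_pdivlMr; last lra.
have := normc_ge0 (s - \sum_(i <- B) f i).
nra.
Qed.

Lemma abs_bounded_le f g M : (forall i, normc (f i) <= normc (g i)) ->
  abs_bounded g M -> abs_bounded f M.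
Proof. by move=> fg gM A; apply: le_trans (gM A); exact: ler_sum. Qed.

Lemma abs_summable_le f g : (forall i, normc (f i) <= normc (g i)) ->
  abs_summable g -> abs_summable f.
Proof. by move=> fg [M gM]; exists M; exact: abs_bounded_le gM. Qed.

Lemma abs_boundedD f g M N : abs_bounded f M -> abs_bounded g N ->
  abs_bounded (f + g) (M + N).
Proof.
move=> fM gN A; apply: le_trans (lerD (fM A) (gN A)); rewrite -big_split/=.
by apply: ler_sum => i _; exact: normcD.
Qed.

Lemma abs_boundedZ c f M : abs_bounded f M -> abs_bounded (c *: f) (normc c * M).
Proof.
move=> fM A; apply: le_trans (ler_wpM2l (normc_ge0 _) (fM A)); rewrite mulr_sumr.
by apply: ler_sum => i _; rewrite normcM.
Qed.

Lemma abs_summableD f g : abs_summable f -> abs_summable g -> abs_summable (f + g).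
Proof. by move=> [M fM] [N gN]; exists (M + N); exact: abs_boundedD. Qed.

Lemma abs_summableZ c f : abs_summable f -> abs_summable (c *: f).
Proof. by move=> [M fM]; exists (normc c * M); exact: abs_boundedZ. Qed.

Lemma abs_summableB f g : abs_summable f -> abs_summable g -> abs_summable (f - g).
Proof. by move=> fs gs; rewrite -scaleN1r; exact/abs_summableD/abs_summableZ. Qed.

Lemma norm1D f g : abs_summable f -> abs_summable g ->
  norm1 (f + g) <= norm1 f + norm1 g.
Proof. by move=> fs gs; apply/norm1_le/abs_boundedD; exact: abs_bounded_norm1. Qed.

Lemma norm1Z c f : abs_summable f -> norm1 (c *: f) <= normc c * norm1 f.
Proof. by move=> fs; apply/norm1_le/abs_boundedZ; exact: abs_bounded_norm1. Qed.

(** The partial sums form an increasing net, so they converge to their supremum. *)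
Lemma has_sum_norm1 f : abs_summable f ->
  has_sum (fun i => (normc (f i))%:C) (norm1 f)%:C.
Proof.
move=> fs e e0; have [A Ae] := norm1_adherent fs e0; exists A => B AB.
rewrite -rmorph_sum -rmorphB normcR ger0_norm ?subr_ge0 ?norm1_ub//.
have := ler_sum_fset (fun i => normc_ge0 (f i)) AB; lra.
Qed.

(** A real family [u] is the difference of the nonnegative families [u + |u|] and [|u|], which
    [has_sum_norm1] handles; a complex family is split into real and imaginary parts. *)
Lemma abs_summable_has_sum f : abs_summable f -> exists s, has_sum f s.
Proof.
move=> fs.
have real_sum (u : I -> R) : (forall i, `|u i| <= normc (f i)) ->
    exists s, has_sum (fun i => (u i)%:C) s.
  move=> uf; pose v i := (u i + `|u i|)%:C.
  have us : abs_summable (fun i => (u i)%:C).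
    by apply: abs_summable_le fs => i; rewrite normcR.
  have vs : abs_summable v.
    apply: (@abs_summable_le _ (2 *: f)); last exact: abs_summableZ.
    move=> i; rewrite normcR normcM (_ : normc 2 = 2).
      by have := uf i; have := ler_normD (u i) `|u i|; rewrite normr_id; lra.
    by rewrite -(rmorph_nat (real_complex R)) normcR ger0_norm.
  have := has_sumD (has_sum_norm1 vs) (has_sumZ (-1) (has_sum_norm1 us)).
  rewrite (_ : _ + _ = fun i => (u i)%:C); first by eexists; eassumption.
  apply/funext => i; rewrite fctE /v.
  rewrite [X in _ + X](_ : _ = - `|u i|%:C); last by rewrite -normcR -[RHS]mulN1r.
  by rewrite normcR -rmorphB ger0_norm ?addrK// -lerBlDr sub0r lerNnormlW.
have [|s Rs] := real_sum (fun i => Re (f i)).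
  move=> i; case: (f i) => a b /=.
  by rewrite -sqrtr_sqr ler_sqrt ?lerDl ?addr_ge0 ?sqr_ge0.
have [|t It] := real_sum (fun i => Im (f i)).
  move=> i; case: (f i) => a b /=.
  by rewrite -sqrtr_sqr ler_sqrt ?lerDr ?addr_ge0 ?sqr_ge0.
exists (s + 'i * t); have := has_sumD Rs (has_sumZ 'i It).
by congr has_sum; apply/funext => i; rewrite [RHS]complexE.
Qed.

Lemma csumP f : abs_summable f -> has_sum f (csum f).
Proof. by move=> /abs_summable_has_sum[s fs]; rewrite (has_sum_csum fs). Qed.

Lemma csumD f g : abs_summable f -> abs_summable g ->
  csum (f + g) = csum f + csum g.
Proof. by move=> fs gs; apply: has_sum_csum; apply: has_sumD; exact: csumP. Qed.

Lemma csumZ c f : abs_summable f -> csum (c *: f) = c * csum f.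
Proof. by move=> fs; apply: has_sum_csum; apply: has_sumZ; exact: csumP. Qed.

Lemma csumB f g : abs_summable f -> abs_summable g ->
  csum (f - g) = csum f - csum g.
Proof.
move=> fs gs; rewrite -scaleN1r csumD ?csumZ ?mulN1r//; exact: abs_summableZ.
Qed.

Lemma normc_csum f : abs_summable f -> normc (csum f) <= norm1 f.
Proof.
move=> fs; apply/ler_addgt0Pr => e e0; have [A sA] := csumP fs e0.
have := normcD (csum f - \sum_(i <- A) f i) (\sum_(i <- A) f i); rewrite subrK.
have := sA _ (fsubset_refl _); have := norm1_ub A fs; have := ler_normc_sum A f.
lra.
Qed.

(** Written as an indicator so that [point_mass R 1%g] is [delta_e] by conversion. *)
Definition point_mass i : I -> R[i] := \1_[set i].

Lemma point_massE i j : point_mass i j = (i == j)%:R.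
Proof. by rewrite /point_mass indicE in_set1 eq_sym. Qed.

Lemma has_sum_point_mass i f : has_sum (fun j => f j * point_mass i j) (f i).
Proof.
move=> e e0; exists [fset i]%fset => B /fsubsetP/(_ i (fset11 _)) iB.
rewrite (big_fsetD1 i)//= big1_fset ?addr0 ?point_massE ?eqxx ?mulr1 ?subrr ?normc0//.
by move=> j; rewrite !inE point_massE eq_sym => /andP[/negPf -> _]; rewrite mulr0.
Qed.

Lemma csum_point_mass i f : csum (fun j => f j * point_mass i j) = f i.
Proof. exact/has_sum_csum/has_sum_point_mass. Qed.

Lemma abs_bounded_point_mass i : abs_bounded (point_mass i) 1.
Proof.
move=> A; case: (boolP (i \in A)) => iA; last first.
  rewrite big1_fset// => j jA _; rewrite point_massE; case: eqP => [ij|_]; last exact: normc0.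
  by rewrite ij jA in iA.
rewrite (big_fsetD1 i)//= big1_fset ?addr0 ?point_massE ?eqxx ?normc1//.
by move=> j; rewrite !inE point_massE eq_sym => /andP[/negPf -> _]; rewrite normc0.
Qed.

Lemma abs_summable_point_mass i : abs_summable (point_mass i).
Proof. by exists 1; exact: abs_bounded_point_mass. Qed.

(** Let [A] carry all but [e] of the norm: for every finite [C], the part of [C] outside [B] is
    disjoint from [A], hence carries at most [e]. *)
Lemma norm1_tail f (e : R) : abs_summable f -> 0 < e -> exists A, forall B,
  (A `<=` B)%fset -> norm1 (fun i => if i \in B then 0 else f i) <= e.
Proof.
move=> fs e0; have [A Ae] := norm1_adherent fs e0; exists A => B AB.
apply: norm1_le => C; rewrite (big_fsetID _ (mem B))/= big1_fset ?add0r; last first.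
  by move=> i; rewrite !inE/= => /andP[_ ->]; rewrite normc0.
have := norm1_ub (B `|` C)%fset fs; rewrite (big_fsetID _ (mem B))/=.
have : (A `<=` [fset x in B `|` C | x \in B])%fset.
  by apply/fsubsetP => i /(fsubsetP AB) iB; rewrite !inE/= iB.
move=> /(ler_sum_fset (fun i => normc_ge0 (f i))).
have : ([fset x in C | x \notin B] `<=` [fset x in B `|` C | x \notin B])%fset.
  by apply/fsubsetP => i; rewrite !inE/= => /andP[-> ->]; rewrite orbT.
move=> /(ler_sum_fset (fun i => normc_ge0 (f i))).
rewrite [X in _ -> _ -> _ -> X <= _](_ : _ = \sum_(i <- [fset x in C | x \notin B]%fset) normc (f i)).
  by lra.
by apply: eq_fbigr => i; rewrite !inE/= => /andP[_ /negPf ->].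
Qed.

(* The dual of l1 is l-infinity; exchanging two sums is an instance of this
   representation, see [csum_kernel]. *)
Lemma csum_representation (Phi : (I -> R[i]) -> R[i]) (M : R) f :
  (forall g h, abs_summable g -> abs_summable h -> Phi (g + h) = Phi g + Phi h) ->
  (forall c g, abs_summable g -> Phi (c *: g) = c * Phi g) ->
  (forall g, abs_summable g -> normc (Phi g) <= M * norm1 g) ->
  abs_summable f -> csum (fun i => f i * Phi (point_mass i)) = Phi f.
Proof.
move=> PhiD PhiZ PhiM fs; apply: has_sum_csum => e e0.
have M0 := normr_ge0 M.
(* The [+ 1] avoids a zero denominator; the [/ 2] turns the weak bound on the tail into a strict
   one. *)
have [|A tailA] := norm1_tail fs (e := e / 2 / (`|M| + 1)).
  by rewrite !divr_gt0//; lra.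
exists A => B /tailA; set r := (fun i => _) => re.
have rs : abs_summable r.
  apply: abs_summable_le fs => i; rewrite /r; case: ifP => // _.
  by rewrite normc0 normc_ge0.
(* Summability goes through the induction together with the value, since [Phi] is additive only on
   summable functions. *)
have [bs PhiB] : abs_summable (\sum_(i <- B) f i *: point_mass i) /\
    Phi (\sum_(i <- B) f i *: point_mass i) = \sum_(i <- B) f i * Phi (point_mass i).
  have s0 : abs_summable (0 : I -> R[i]).
    by rewrite -(scale0r f); exact: abs_summableZ.
  apply: (big_ind2 (fun u a => abs_summable u /\ Phi u = a)) => [|u a v b [us <-] [vs <-]|i _].
  - by rewrite -(scale0r f) PhiZ ?mul0r ?scale0r.
  - by rewrite PhiD//; split => //; exact: abs_summableD.
  - by split; [exact/abs_summableZ/abs_summable_point_mass|rewrite PhiZ//; exact: abs_summable_point_mass].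
have fE : f = r + \sum_(i <- B) f i *: point_mass i.
  have dE i j : (f j *: point_mass j) i = f j * (j == i)%:R by rewrite -point_massE.
  apply/funext => i; rewrite fctE fct_sumE /r; case: ifP => iB.
    rewrite add0r (big_fsetD1 i)//= dE eqxx mulr1 big1_fset ?addr0// => j.
    by rewrite !inE dE => /andP[/negPf -> _]; rewrite mulr0.
  rewrite big1_fset ?addr0// => j jB _; rewrite dE.
  by case: eqP => [ji|_]; [rewrite ji iB in jB|rewrite mulr0].
rewrite {1}fE PhiD// PhiB addrK; apply: le_lt_trans (PhiM _ rs) _.
move: re; rewrite ler_pdivlMr ?mulrDr ?mulr1; last lra.
have := ler_wpM2r (norm1_ge0 rs) (ler_norm M); have := norm1_ge0 rs; rewrite (mulrC _ `|M|); lra.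
Qed.

End Summation.

(** * Kernel operators and exchange of sums *)

Section Multipliers.
Variables (R : realType) (I : choiceType).
Implicit Types (f b : I -> R[i]).

Lemma abs_boundedM b f M N : 0 <= M -> (forall i, normc (b i) <= M) ->
  abs_bounded f N -> abs_bounded (fun i => b i * f i) (M * N).
Proof.
move=> M0 bM fN A; apply: le_trans (ler_wpM2l M0 (fN A)); rewrite mulr_sumr.
by apply: ler_sum => i _; rewrite normcM ler_wpM2r ?normc_ge0.
Qed.

Lemma abs_summableM b f M : (forall i, normc (b i) <= M) ->
  abs_summable f -> abs_summable (fun i => b i * f i).
Proof.
move=> bM [N fN]; exists (`|M| * N); apply: abs_boundedM => // i.
exact: le_trans (bM i) (ler_norm M).
Qed.

Lemma has_sum_sum (J : Type) (s : seq J) (F : J -> I -> R[i]) (a : J -> R[i]) :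
  (forall j, has_sum (F j) (a j)) ->
  has_sum (\sum_(j <- s) F j) (\sum_(j <- s) a j).
Proof.
move=> Fa; apply: (big_ind2 (@has_sum R I)) => //; first exact: has_sum0.
by move=> *; exact: has_sumD.
Qed.

End Multipliers.

Section Kernel.
Variables (R : realType) (I J : choiceType) (K : I -> J -> R[i]) (M : R).
Hypothesis M0 : 0 <= M.
Hypothesis KM : forall j, abs_bounded (K^~ j) M.
Implicit Types (f : J -> R[i]) (b : I -> R[i]).

(** By [KM] the columns of [K] are uniformly bounded in l1, so this is a bounded operator from l1(J)
    to l1(I), sending [point_mass] at [j] to column [j]. Convolution, change of variables and the
    Neumann series are all instances. *)
Definition kernel_op f i := csum (fun j => K i j * f j).

Lemma normc_kernel i j : normc (K i j) <= M.
Proof. by have := KM j [fset i]%fset; rewrite big_seq_fset1. Qed.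

Lemma kernel_op_summable f i : abs_summable f -> abs_summable (fun j => K i j * f j).
Proof. exact: abs_summableM (normc_kernel i). Qed.

(** The finite sum over [A] can be moved inside the sum over [J] by [has_sum_sum]; there the index
    [j] contributes at most [M] times the modulus of [f j]. *)
Lemma kernel_op_bounded f : abs_summable f -> abs_bounded (kernel_op f) (M * norm1 f).
Proof.
move=> fs A; pose n i := norm1 (fun j => K i j * f j).
have n0 i : 0 <= n i by apply/norm1_ge0/kernel_op_summable.
apply: (@le_trans _ _ (\sum_(i <- A) n i)).
  by apply: ler_sum => i _; apply/normc_csum/kernel_op_summable.
have wn := has_sum_sum A (fun i => has_sum_norm1 (kernel_op_summable i fs)).
rewrite -rmorph_sum in wn; set w := (X in has_sum X _) in wn.
have w_bd : abs_bounded w (M * norm1 f).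
  move=> B; apply: le_trans (ler_wpM2l M0 (norm1_ub B fs)); rewrite mulr_sumr.
  apply: ler_sum => j _; rewrite /w fct_sumE; apply: le_trans (ler_normc_sum _ _) _.
  under eq_bigr do rewrite normcR ger0_norm ?normc_ge0// normcM.
  by rewrite -mulr_suml ler_wpM2r ?normc_ge0 ?KM.
rewrite -[leLHS]ger0_norm ?sumr_ge0// -normcR -(has_sum_csum wn).
by apply: le_trans (normc_csum _) (norm1_le w_bd); exists (M * norm1 f).
Qed.

Lemma kernel_op_sum f : abs_summable f -> abs_summable (kernel_op f).
Proof. by move=> fs; exists (M * norm1 f); exact: kernel_op_bounded. Qed.

Lemma kernel_op_point_mass j : kernel_op (point_mass R j) = K^~ j.
Proof. by apply/funext => i; exact: csum_point_mass. Qed.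

(** A Fubini theorem: the left side is a bounded linear functional of [f] whose value at a point
    mass is the pairing of [b] with a column, so [csum_representation] yields the right side. *)
Lemma csum_kernel b N f : (forall i, normc (b i) <= N) -> abs_summable f ->
  csum (fun i => b i * kernel_op f i) =
  csum (fun j => f j * csum (fun i => b i * K i j)).
Proof.
move=> bN fs; pose Phi g := csum (fun i => b i * kernel_op g i).
have PhiE j : csum (fun i => b i * K i j) = Phi (point_mass R j).
  by rewrite /Phi kernel_op_point_mass.
under [in RHS]eq_fun do rewrite PhiE.
have bs g : abs_summable g -> abs_summable (fun i => b i * kernel_op g i).
  by move=> /kernel_op_sum; exact: abs_summableM bN.
rewrite (@csum_representation _ _ Phi (`|N| * M))//.
- move=> g h gs hs; rewrite /Phi -csumD; [|exact: bs|exact: bs].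
  congr csum; apply/funext => i.
  rewrite fctE -mulrDr; congr (_ * _).
  apply: etrans (csumD _ _); [congr csum|exact: kernel_op_summable..].
  by apply/funext => j; rewrite !fctE mulrDr.
- move=> c g gs; rewrite /Phi -csumZ; last exact: bs.
  congr csum; apply/funext => i.
  rewrite [RHS]mulrCA; congr (_ * _).
  apply: etrans (csumZ _ _); [congr csum|exact: kernel_op_summable].
  by apply/funext => j; rewrite [RHS]mulrCA.
- move=> g gs; apply: le_trans (normc_csum (bs g gs)) _; apply: norm1_le.
  rewrite -mulrA; apply: abs_boundedM (kernel_op_bounded gs) => // i.
  exact: le_trans (bN i) (ler_norm N).
Qed.

End Kernel.

(** * Change of variables in sums *)

Section Reindex.
Variables (R : realType) (I J : choiceType) (phi : J -> I).
Hypothesis phi_inj : injective phi.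
Implicit Types (f : I -> R[i]).

(** Composition with [phi] is the operator of a 0-1 matrix; by injectivity each of its columns has
    at most one nonzero entry. *)
Let dirac_bounded i : abs_bounded (fun j => point_mass R (phi j) i) 1.
Proof.
have [[j0 <-]|nphi] := pselect (exists j, phi j = i).
  rewrite (_ : (fun j => _) = point_mass R j0); first exact: abs_bounded_point_mass.
  by apply/funext => j; rewrite !point_massE (inj_eq phi_inj) eq_sym.
move=> A; rewrite big1_seq// => j _; rewrite point_massE.
by case: eqP => [ji|_]; [case: nphi; exists j|exact: normc0].
Qed.

Let dirac_op f : kernel_op (fun j => point_mass R (phi j)) f = f \o phi.
Proof.
apply/funext => j; rewrite /= -[RHS](csum_point_mass (phi j)); congr csum.
by apply/funext => i; rewrite mulrC.
Qed.

Lemma abs_bounded_comp f : abs_summable f -> abs_bounded (f \o phi) (norm1 f).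
Proof.
by move=> fs; rewrite -dirac_op -[norm1 f]mul1r; exact: kernel_op_bounded.
Qed.

(** Pair the constant 1 with this matrix and exchange the sums: the inner sum counts the preimages
    of [i], which is 1 on the image of [phi], and [f] vanishes off the image. *)
Lemma csum_comp f : abs_summable f ->
  (forall i, (forall j, phi j <> i) -> f i = 0) -> csum (f \o phi) = csum f.
Proof.
move=> fs f0; have := csum_kernel ler01 dirac_bounded (b := fun=> 1) (N := 1) _ fs.
rewrite dirac_op; under [in LHS]eq_fun do rewrite mul1r.
move=> ->; last by move=> _; rewrite normc1.
congr csum; apply/funext => i; under eq_fun do rewrite mul1r.
have [[j0 <-]|nphi] := pselect (exists j, phi j = i); last first.
  by rewrite f0 ?mul0r// => j ji; apply: nphi; exists j.
rewrite -[RHS]mulr1 -(csum_point_mass j0 (fun=> 1)); congr (_ * csum _).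
by apply/funext => j; rewrite !point_massE (inj_eq phi_inj) eq_sym mul1r.
Qed.

Lemma csum_reindex psi f : abs_summable f -> cancel psi phi ->
  csum (f \o phi) = csum f.
Proof. by move=> fs psiK; apply: csum_comp => // i /(_ (psi i)). Qed.

End Reindex.

(** * Convolution *)

Local Notation "a '**' b" := (convolution a b) (at level 40, left associativity).

(** * Absolute summability and boundedness in terms of real bounds *)

Section Bridge.
Variables (R : realType) (G : groupType).
Implicit Types (f g : G -> R[i]).

(** The extended sum is the supremum of the finite partial sums, so it is finite exactly when these
    have a common real bound. *)
Lemma l1P f : l1 f <-> abs_summable f.
Proof.
have esumE : (\esum_(x in [set: G]) `| (normc (f x))%:E |%E)%E =
    (\esum_(x in [set: G]) (normc (f x))%:E)%E.
  by apply: eq_esum => x _; rewrite gee0_abs// lee_fin normc_ge0.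
rewrite /l1 /= /summable esumE; split => [fs|[M fM]].
  exists (fine (\esum_(x in [set: G]) (normc (f x))%:E)%E) => A.
  rewrite -lee_fin fineK; last first.
    by rewrite ge0_fin_numE// esum_ge0// => x _; rewrite lee_fin normc_ge0.
  apply: esum_ge; exists [set` A]; first by split=> //; exact: finite_fset.
  by rewrite fsbig_finite ?finite_fset//= set_fsetK -sumEFin.
apply: (@le_lt_trans _ _ M%:E); last exact: ltry.
apply: ge_ereal_sup => _ [X [Xfin _] <-].
by rewrite fsbig_finite//= sumEFin lee_fin.
Qed.

Definition bounded_by f (M : R) := forall x, normc (f x) <= M.

Lemma linftyP f : linfty R G f <-> exists M, bounded_by f M.
Proof.
split => [[M [Mreal fM]]|[M fM]].
  (* The [M] of [bounded_fun] lies in [R[i]] and only numbers strictly above it are known to be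
     bounds, hence the [+ 1]. *)
  exists (normc M + 1) => x; rewrite -lecR -normr_normc.
  apply: (fM _ _ x I); apply: (@le_lt_trans _ _ (normc M)%:C).
    by rewrite -normr_normc real_ler_norm.
  by rewrite ltcR ltrDl.
exists M%:C; split; first by rewrite complex_real.
by move=> N MN x _; apply: le_trans (ltW MN); rewrite normr_normc lecR.
Qed.

End Bridge.

Section Convolution.
Variables (R : realType) (G : groupType).
Implicit Types (a b c f g h u : G -> R[i]) (x y z : G).

Local Notation delta := (point_mass R).

Lemma abs_bounded_translate h y : abs_summable h ->
  abs_bounded (fun z => h (z * y^-1)%g) (norm1 h).
Proof. by move=> hs; apply: abs_bounded_comp hs; exact: mulIg. Qed.

Lemma convolutionE h f : h ** f = kernel_op (fun z y => h (z * y^-1)%g) f.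
Proof. by []. Qed.

Lemma rhoE f g x : rho f g x = csum (fun y => g (x * y)%g * f y).
Proof. by []. Qed.

Lemma abs_bounded_convolution h f : abs_summable h -> abs_summable f ->
  abs_bounded (h ** f) (norm1 h * norm1 f).
Proof.
move=> hs fs; apply: kernel_op_bounded => //; first exact: norm1_ge0.
by move=> y; exact: abs_bounded_translate.
Qed.

Lemma abs_summable_convolution h f : abs_summable h -> abs_summable f ->
  abs_summable (h ** f).
Proof. by move=> *; eexists; exact: abs_bounded_convolution. Qed.

Lemma norm1_convolution h f : abs_summable h -> abs_summable f ->
  norm1 (h ** f) <= norm1 h * norm1 f.
Proof. by move=> *; apply/norm1_le/abs_bounded_convolution. Qed.

Lemma convolution_summable h f z : abs_summable h -> abs_summable f ->
  abs_summable (fun y => h (z * y^-1)%g * f y).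
Proof. by move=> hs; apply: abs_summableM => y; exact: normc_le_norm1. Qed.

Lemma convolutionDl a b f : abs_summable a -> abs_summable b -> abs_summable f ->
  (a + b) ** f = a ** f + b ** f.
Proof.
move=> as_ bs fs; apply/funext => z.
apply: etrans (csumD _ _); [congr csum|exact: convolution_summable..].
by apply/funext => y; rewrite !fctE mulrDl.
Qed.

Lemma convolutionDr h a b : abs_summable h -> abs_summable a -> abs_summable b ->
  h ** (a + b) = h ** a + h ** b.
Proof.
move=> hs as_ bs; apply/funext => z.
apply: etrans (csumD _ _); [congr csum|exact: convolution_summable..].
by apply/funext => y; rewrite !fctE mulrDr.
Qed.

Lemma convolutionZl (c : R[i]) h f : abs_summable h -> abs_summable f ->
  (c *: h) ** f = c *: (h ** f).
Proof.
move=> hs fs; apply/funext => z.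
apply: etrans (csumZ _ _); [congr csum|exact: convolution_summable].
by apply/funext => y; exact: esym (mulrA _ _ _).
Qed.

Lemma convolutionZr (c : R[i]) h f : abs_summable h -> abs_summable f ->
  h ** (c *: f) = c *: (h ** f).
Proof.
move=> hs fs; apply/funext => z.
apply: etrans (csumZ _ _); [congr csum|exact: convolution_summable].
by apply/funext => y; exact: mulrCA.
Qed.

Lemma convolutionBl a b f : abs_summable a -> abs_summable b -> abs_summable f ->
  (a - b) ** f = a ** f - b ** f.
Proof.
move=> as_ bs fs; rewrite -scaleN1r convolutionDl//; last exact: abs_summableZ.
by rewrite convolutionZl// scaleN1r.
Qed.

Lemma convolutionBr h a b : abs_summable h -> abs_summable a -> abs_summable b ->
  h ** (a - b) = h ** a - h ** b.
Proof.
move=> hs as_ bs; rewrite -scaleN1r convolutionDr//; last exact: abs_summableZ.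
by rewrite convolutionZr// scaleN1r.
Qed.

Lemma convolution_deltal x f z : (delta x ** f) z = f (x^-1 * z)%g.
Proof.
rewrite -(csum_point_mass (x^-1 * z)%g f); congr csum; apply/funext => y.
rewrite mulrC !point_massE; congr (_ * (nat_of_bool _)%:R).
by apply/eqP/eqP => [->|<-]; rewrite invgM invgK ?mulgVK ?mulVKg.
Qed.

Lemma convolution_deltar x f z : (f ** delta x) z = f (z * x^-1)%g.
Proof. exact: (csum_point_mass x (fun y => f (z * y^-1)%g)). Qed.

Lemma convolution1l f : delta 1%g ** f = f.
Proof. by apply/funext => z; rewrite convolution_deltal invg1 mul1g. Qed.

Lemma convolution1r f : f ** delta 1%g = f.
Proof. by apply/funext => z; rewrite convolution_deltar invg1 mulg1. Qed.

(** After [csum_kernel] exchanges the sums, the inner variable is replaced by [w * y]. *)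
Lemma convolutionA a b c : abs_summable a -> abs_summable b -> abs_summable c ->
  a ** (b ** c) = (a ** b) ** c.
Proof.
move=> as_ bs cs; apply/funext => z.
rewrite [LHS](csum_kernel (norm1_ge0 bs) (fun y => abs_bounded_translate y bs) (N := norm1 a))//.
  congr csum; apply/funext => y; rewrite mulrC; congr (_ * _).
  rewrite -(csum_reindex (phi := fun w => (w * y)%g) (mulIg y)
    (psi := fun x => (x * y^-1)%g)).
  - congr csum; apply/funext => w /=; rewrite mulgK; congr (a _ * _).
    by rewrite invgM mulgA.
  - apply: (abs_summableM (M := norm1 a)); last by eexists; exact: abs_bounded_translate.
    by move=> x; exact: normc_le_norm1.
  - by move=> x; rewrite mulgVK.
by move=> x; exact: normc_le_norm1.
Qed.

(** The function [f ** g] is rewritten as a kernel operator applied to [f], with the left translates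
    of [g] as columns. Then [csum_kernel] applies, with a translate of [u] as bounded weight. *)
Lemma rho_convolution f g u M : abs_summable f -> abs_summable g ->
  bounded_by u M -> rho f (rho g u) = rho (f ** g) u.
Proof.
move=> fs gs uM; apply/funext => x.
have gK y : abs_bounded (fun w => g (y^-1 * w)%g) (norm1 g).
  by apply: abs_bounded_comp gs; exact: mulgI.
have convE w : (f ** g) w = kernel_op (fun w y => g (y^-1 * w)%g) f w.
  rewrite convolutionE /kernel_op.
  rewrite -(csum_reindex (phi := fun y => (y^-1 * w)%g) _
    (psi := fun y => (w * y^-1)%g)).
  - congr csum; apply/funext => y /=; rewrite mulrC; congr (_ * f _).
    by rewrite invgM invgK mulgA mulgV mul1g.
  - by move=> y y' /mulIg/invg_inj.
  - exact: convolution_summable.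
  - by move=> y; rewrite invgM invgK mulgVK.
rewrite [RHS]rhoE; under [in RHS]eq_fun do rewrite convE.
rewrite [RHS](csum_kernel (norm1_ge0 gs) gK (N := M))//.
congr csum; apply/funext => y; rewrite mulrC; congr (_ * _).
rewrite rhoE -[RHS](csum_reindex (phi := fun w => (y * w)%g) (mulgI _)
  (psi := fun w => (y^-1 * w)%g)).
- by congr csum; apply/funext => w /=; rewrite mulgA mulKg.
- by apply: (abs_summableM (M := M)) => //; eexists; exact: gK.
- by move=> w; rewrite mulVKg.
Qed.

Lemma bounded_by_rho f u M : abs_summable f -> 0 <= M -> bounded_by u M ->
  bounded_by (rho f u) (M * norm1 f).
Proof.
move=> fs M0 uM x; have uMf := abs_boundedM M0 (fun y => uM (x * y)%g) (abs_bounded_norm1 fs).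
by apply: le_trans (normc_csum _) (norm1_le uMf); eexists; exact: uMf.
Qed.

Lemma rho_delta u : rho (delta 1%g) u = u.
Proof.
by apply/funext => x; rewrite rhoE (csum_point_mass 1%g (fun y => u (x * y)%g)) mulg1.
Qed.

End Convolution.

(** * Hahn-Banach *)

Section HahnBanach.
Variables (R : realType) (V : lmodType R[i]) (D : set V).
Hypothesis DD : forall x y, D x -> D y -> D (x + y).
Hypothesis DZ : forall c x, D x -> D (c *: x).
Implicit Types (x y z : V) (p q : V -> R) (r t : R).

(** Everything is relative to the subspace [D], since l1 is a subset of the space of all functions,
    and only real scalars matter here. Homogeneity is an inequality, which is easier to check for
    infima; [sublinearZ] recovers equality. *)
Definition sublinear q :=
  (forall x y, D x -> D y -> q (x + y) <= q x + q y) /\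
  (forall r x, 0 <= r -> D x -> q (r%:C *: x) <= r * q x).

Let DN x : D x -> D (- x).
Proof. by rewrite -scaleN1r; exact: DZ. Qed.

Let D0 x : D x -> D 0.
Proof. by move=> Dx; rewrite -(scale0r x); exact: DZ. Qed.

Lemma sublinear0 q x : sublinear q -> D x -> q 0 = 0.
Proof.
move=> [qD qZ] Dx; apply/eqP; rewrite eq_le; apply/andP; split.
  by have := qZ _ _ (lexx 0) Dx; rewrite scale0r mul0r.
by have := qD _ _ Dx (D0 Dx); rewrite addr0 lerDl.
Qed.

Lemma sublinearN q x : sublinear q -> D x -> - q (- x) <= q x.
Proof.
move=> qs Dx; have := qs.1 _ _ Dx (DN Dx).
by rewrite subrr (sublinear0 qs Dx) -lerBlDr sub0r.
Qed.

Lemma sublinearZ q r x : sublinear q -> 0 <= r -> D x -> q (r%:C *: x) = r * q x.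
Proof.
move=> qs; rewrite le_eqVlt => /predU1P[<- Dx|r0 Dx].
  by rewrite scale0r mul0r (sublinear0 qs Dx).
apply/eqP; rewrite eq_le qs.2 ?(ltW r0)//= -ler_pdivlMl//.
apply: le_trans (qs.2 _ _ _ (DZ _ Dx)); last by rewrite invr_ge0 ltW.
by rewrite scalerA -rmorphM mulVf ?gt_eqF// scale1r.
Qed.

Section Lowering.
Variables (q : V -> R) (y : V).
Hypotheses (qs : sublinear q) (Dy : D y).

(* Lowering [q] in the direction [y] makes it linear along [y]; a minimal sublinear
   functional is not changed by it, hence is additive. *)
Definition lowering x : R :=
  inf [set q (x + t%:C *: y) - t * q y | t in [set t | 0 <= t]].

(** This is subadditivity for [t y = - x + (x + t y)]; it keeps the infimum finite. *)
Let lbounded x : D x ->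
  lbound [set q (x + t%:C *: y) - t * q y | t in [set t | 0 <= t]] (- q (- x)).
Proof.
move=> Dx _ [t /= t0 <-]; rewrite -(sublinearZ qs t0 Dy) lerBrDr addrC.
apply: le_trans (_ : q (- x) + q (x + t%:C *: y) - q (- x) <= _); last by rewrite addrC addKr.
rewrite lerB//; apply: le_trans (qs.1 _ _ (DN Dx) (DD Dx (DZ _ Dy))).
by rewrite addKr.
Qed.

Lemma lowering_le x t : D x -> 0 <= t -> lowering x <= q (x + t%:C *: y) - t * q y.
Proof.
by move=> Dx t0; apply: ge_inf; [exists (- q (- x)); exact: lbounded|exists t].
Qed.

Lemma le_lowering x (a : R) :
  (forall t, 0 <= t -> a <= q (x + t%:C *: y) - t * q y) -> a <= lowering x.
Proof.
move=> aq; apply: lb_le_inf; last by move=> _ [t t0 <-]; exact: aq.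
by exists (q (x + 0%:C *: y) - 0 * q y), 0 => /=.
Qed.

Lemma lowering_sublinear : sublinear lowering.
Proof.
split => [x z Dx Dz|r x].
  rewrite -lerBlDr; apply: le_lowering => t t0.
  rewrite lerBlDr -lerBlDl; apply: le_lowering => u u0.
  rewrite lerBlDl; apply: le_trans (lowering_le (DD Dx Dz) (addr_ge0 t0 u0)) _.
  rewrite rmorphD scalerDl addrACA.
  have := qs.1 _ _ (DD Dx (DZ t%:C Dy)) (DD Dz (DZ u%:C Dy)); lra.
rewrite le_eqVlt => /predU1P[<- Dx|r0 Dx].
  rewrite mul0r scale0r; apply: le_trans (lowering_le (D0 Dx) (lexx 0)) _.
  by rewrite scale0r addr0 (sublinear0 qs Dx) mul0r subr0.
rewrite -ler_pdivrMl//; apply: le_lowering => t t0; rewrite ler_pdivrMl//.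
apply: le_trans (lowering_le (DZ _ Dx) (mulr_ge0 (ltW r0) t0)) _.
rewrite mulrBr mulrA lerB// rmorphM -scalerA -scalerDr.
exact: qs.2 (ltW r0) (DD Dx (DZ _ Dy)).
Qed.

Lemma lowering_le_id x : D x -> lowering x <= q x.
Proof.
move=> Dx; apply: le_trans (lowering_le Dx (lexx 0)) _.
by rewrite scale0r addr0 mul0r subr0.
Qed.

Lemma lowering_leD x : D x -> lowering x <= q (x + y) - q y.
Proof.
by move=> Dx; have := lowering_le Dx ler01; rewrite scale1r mul1r.
Qed.

End Lowering.

(** Zorn's lemma. A chain is bounded by its pointwise infimum, which is finite because every member
    is at least [- p (- x)], and subadditive because any two members are comparable. *)
Lemma minimal_sublinear p : sublinear p -> exists q,
  [/\ sublinear q, forall x, D x -> q x <= p x &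
      forall q', sublinear q' -> (forall x, D x -> q' x <= q x) ->
      forall x, D x -> q x <= q' x].
Proof.
move=> ps.
pose T := {q | sublinear q /\ forall x, D x -> q x <= p x}.
(* The pointwise order is reversed, so that a maximal element is a minimal functional. *)
pose below (q1 q2 : T) := `[< forall x, D x -> sval q2 x <= sval q1 x >].
pose t0 : T := exist _ p (conj ps (fun x _ => lexx (p x))).
have [|||[q [qs qp]] qmin] := @ZL_preorder T t0 below.
- by move=> q; apply/asboolP.
- move=> q1 q2 q3 /asboolP q21 /asboolP q32; apply/asboolP => x Dx.
  exact: le_trans (q32 x Dx) (q21 x Dx).
- move=> A Atot; have [[a0 Aa0]|A0] := pselect (exists a, A a); last first.
    by exists t0 => s As; case: A0; exists s.
  pose E x := [set sval a x | a in A]; pose q x := inf (E x).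
  have Elb x : D x -> lbound (E x) (- p (- x)).
    move=> Dx _ [[a [as_ ap]] Aa <-] /=.
    by apply: le_trans (sublinearN as_ Dx); rewrite lerN2 ap//; exact: DN.
  have qE x a : D x -> A a -> q x <= sval a x.
    by move=> Dx Aa; apply: ge_inf; [exists (- p (- x)); exact: Elb|exists a].
  have leq_inf x b : (forall a, A a -> b <= sval a x) -> b <= q x.
    move=> ba; apply: lb_le_inf; first by exists (sval a0 x), a0.
    by move=> _ [a Aa <-]; exact: ba.
  have qs : sublinear q.
    split => [x z Dx Dz|r x].
      rewrite -lerBlDr; apply: (leq_inf) => a Aa.
      rewrite lerBlDr -lerBlDl. apply: (leq_inf) => b Ab; rewrite lerBlDl.
      have [/asboolP ba|/asboolP ab] := Atot _ _ Aa Ab.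
        apply: le_trans (qE _ _ (DD Dx Dz) Ab) _.
        apply: le_trans ((svalP b).1.1 _ _ Dx Dz) _.
        by rewrite lerD2r ba.
      apply: le_trans (qE _ _ (DD Dx Dz) Aa) _.
      apply: le_trans ((svalP a).1.1 _ _ Dx Dz) _.
      by rewrite lerD2l ab.
    rewrite le_eqVlt => /predU1P[<- Dx|r0 Dx].
      rewrite mul0r scale0r; apply: le_trans (qE _ _ (D0 Dx) Aa0) _.
      by rewrite (sublinear0 (svalP a0).1 Dx).
    rewrite -ler_pdivrMl//; apply: (leq_inf) => a Aa; rewrite ler_pdivrMl//.
    apply: le_trans (qE _ _ (DZ _ Dx) Aa) _.
    exact: (svalP a).1.2 (ltW r0) Dx.
  have qp x : D x -> q x <= p x.
    by move=> Dx; exact: le_trans (qE _ _ Dx Aa0) ((svalP a0).2 _ Dx).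
  by exists (exist _ q (conj qs qp)) => a Aa; apply/asboolP => x Dx /=; exact: qE.
exists q; split => // q' q's q'q.
have q'p x : D x -> q' x <= p x.
  by move=> Dx; exact: le_trans (q'q x Dx) (qp x Dx).
by have /(_ _)/asboolP := qmin (exist _ q' (conj q's q'p)); apply; apply/asboolP.
Qed.

(** No functional is extended from a subspace. Take [l] minimal below the lowering of [p] along [v]:
    comparison with its own lowering along [y] gives [l x <= l (x + y) - l y], hence additivity,
    while the first lowering gives [l (- v) <= p 0 - p v = - p v]. *)
Lemma sublinear_dominates_linear p v : sublinear p -> D v -> exists l : V -> R,
  [/\ forall x y, D x -> D y -> l (x + y) = l x + l y,
      forall r x, D x -> l (r%:C *: x) = r * l x,
      forall x, D x -> l x <= p x & p v <= l v].
Proof.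
move=> ps Dv; have p's := lowering_sublinear ps Dv.
have [l [ls lp' lmin]] := minimal_sublinear p's; exists l.
have lD x y : D x -> D y -> l (x + y) = l x + l y.
  move=> Dx Dy; apply/eqP; rewrite eq_le ls.1//= -lerBrDr.
  apply: le_trans (lowering_leD ls Dy Dx).
  by apply: (lmin) => //; [exact: lowering_sublinear|move=> z; exact: lowering_le_id].
have lN x : D x -> l (- x) = - l x.
  by move=> Dx; apply/eqP; rewrite -addr_eq0 -lD ?addNr ?(sublinear0 ls Dx)//; exact: DN.
split => //.
- move=> r x Dx; have [r0|r0] := leP 0 r; first exact: sublinearZ.
  rewrite -[in LHS](opprK r) rmorphN scaleNr lN; last exact: DZ.
  by rewrite sublinearZ// ?oppr_ge0 ?ltW// mulNr opprK.
- by move=> x Dx; apply: le_trans (lp' x Dx) (lowering_le_id ps Dv Dx).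
- rewrite -lerN2 -lN//; apply: le_trans (lp' _ (DN Dv)) _.
  apply: le_trans (lowering_leD ps Dv (DN Dv)) _.
  by rewrite addNr (sublinear0 ps Dv) sub0r.
Qed.

(** The usual complexification [l x - i l (i x)] of a real functional. The constant 2 comes from
    bounding the two terms separately, and the real part at [v] is at least [p v > 0]. *)
Lemma seminorm_dominates_functional p v :
  (forall x y, D x -> D y -> p (x + y) <= p x + p y) ->
  (forall c x, D x -> p (c *: x) <= normc c * p x) -> D v -> 0 < p v ->
  exists Phi : V -> R[i],
  [/\ forall x y, D x -> D y -> Phi (x + y) = Phi x + Phi y,
      forall c x, D x -> Phi (c *: x) = c * Phi x,
      forall x, D x -> normc (Phi x) <= 2 * p x & Phi v <> 0].
Proof.
move=> pD pZ Dv pv0; have ps : sublinear p.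
  by split => // r x r0 Dx; apply: le_trans (pZ _ _ Dx) _; rewrite normcR ger0_norm.
have [l [lD lZ lp pl]] := sublinear_dominates_linear ps Dv.
exists (fun x => (l x)%:C - 'i%C * (l ('i%C *: x))%:C); split.
- move=> x y Dx Dy; rewrite scalerDr !lD//; try exact: DZ.
  by rewrite !rmorphD/=; ring.
- move=> [a b] x Dx; rewrite [a +i* b]complexE/= scalerDl.
  have -> : 'i%C *: (a%:C *: x + ('i%C * b%:C) *: x) = a%:C *: ('i%C *: x) + (- b)%:C *: x.
    by rewrite scalerDr !scalerA mulrA -expr2 sqr_i mulN1r rmorphN [_ * 'i%C]mulrC.
  have -> : ('i%C * b%:C) *: x = b%:C *: ('i%C *: x) by rewrite scalerA mulrC.
  rewrite !lD ?lZ//; try by do ?apply: DZ.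
  rewrite !rmorphD !rmorphM rmorphN/=; set i := 'i%C; set B := l (i *: x).
  transitivity (a%:C * (l x)%:C - i * (a%:C * B%:C) + i * (b%:C * (l x)%:C)
    - i ^+ 2 * (b%:C * B%:C)); last by ring.
  by rewrite sqr_i; ring.
- move=> x Dx.
  have labs y : D y -> `|l y| <= p y.
    move=> Dy; rewrite ler_norml lp// andbT lerNl.
    have -> : - l y = l (- y).
      by have := lZ (-1) y Dy; rewrite rmorphN1 scaleN1r mulN1r.
    apply: le_trans (lp _ (DN Dy)) _; rewrite -scaleN1r.
    by apply: le_trans (pZ _ _ Dy) _; rewrite normc_opp normc1 mul1r.
  apply: le_trans (normcB _ _) _; rewrite normcM !normcR.
  have -> : normc ('i%C : R[i]) = 1 by rewrite /= expr0n add0r expr1n sqrtr1.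
  rewrite mul1r mulr_natl mulr2n lerD ?labs//.
  apply: le_trans (labs _ (DZ _ Dx)) _; apply: le_trans (pZ _ _ Dx) _.
  by rewrite /= expr0n add0r expr1n sqrtr1 mul1r.
- move=> /(congr1 (@complex.Re R)) /=; rewrite mul0r mulr0 subrr oppr0 addr0 => lv0.
  by move: pl; rewrite lv0 leNgt pv0.
Qed.

End HahnBanach.

(** * Left inverses *)

Section LeftInverse.
Variables (R : realType) (G : groupType) (f : G -> R[i]).
Hypothesis fs : abs_summable f.
Implicit Types (a h u v : G -> R[i]).

Local Notation delta := (point_mass R).

(* The quotient seminorm of l1 modulo the left ideal l1 * f. *)
Let dist a : R := inf [set norm1 (a - h ** f) | h in @abs_summable R G].

Let summable0 : abs_summable (0 : G -> R[i]).
Proof. by rewrite -(scale0r f); exact: abs_summableZ. Qed.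

Let conv0 : 0 ** f = 0.
Proof. by have := convolutionZl 0 fs fs; rewrite !scale0r. Qed.

Let summableBM a h : abs_summable a -> abs_summable h -> abs_summable (a - h ** f).
Proof. by move=> as_ hs; apply/abs_summableB => //; exact: abs_summable_convolution. Qed.

Let dist_le a h : abs_summable a -> abs_summable h -> dist a <= norm1 (a - h ** f).
Proof.
move=> as_ hs; apply: ge_inf; last by exists h.
by exists 0 => _ [k ks <-]; exact/norm1_ge0/summableBM.
Qed.

Let le_dist a (M : R) :
  (forall h, abs_summable h -> M <= norm1 (a - h ** f)) -> M <= dist a.
Proof.
move=> Ma; apply: lb_le_inf; last by move=> _ [h hs <-]; exact: Ma.
by exists (norm1 (a - 0 ** f)), 0.
Qed.

Let dist_le_norm1 a : abs_summable a -> dist a <= norm1 a.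
Proof. by move=> as_; have := dist_le as_ summable0; rewrite conv0 subr0. Qed.

Let norm1_0 : norm1 (0 : G -> R[i]) <= 0.
Proof. by apply: norm1_le => A; rewrite big1// => x _; exact: normc0. Qed.

Let distD a b : abs_summable a -> abs_summable b -> dist (a + b) <= dist a + dist b.
Proof.
move=> as_ bs; rewrite -lerBlDr; apply: le_dist => h hs.
rewrite lerBlDr -lerBlDl; apply: le_dist => k ks; rewrite lerBlDl.
apply: le_trans (dist_le (abs_summableD as_ bs) (abs_summableD hs ks)) _.
rewrite convolutionDl// opprD addrACA.
by apply: norm1D; exact: summableBM.
Qed.

Let distZ (c : R[i]) a : abs_summable a -> dist (c *: a) <= normc c * dist a.
Proof.
move=> as_; have [->|c0] := eqVneq c 0.
  rewrite scale0r normc0 mul0r; exact: le_trans (dist_le_norm1 summable0) norm1_0.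
have c_gt0 : 0 < normc c.
  rewrite lt_neqAle normc_ge0 andbT eq_sym; apply: contra c0.
  by move=> /eqP/eq0_normc/eqP.
rewrite -ler_pdivrMl//; apply: le_dist => h hs; rewrite ler_pdivrMl//.
apply: le_trans (dist_le (abs_summableZ c as_) (abs_summableZ c hs)) _.
by rewrite convolutionZl// -scalerBr; exact/norm1Z/summableBM.
Qed.

(** If the ideal stays at distance at least [e] from the unit, a nonzero functional [Phi] dominated
    by [dist] kills the ideal; its values at the point masses form a nonzero bounded function in the
    kernel of [rho f]. *)
Lemma rho_injective_dense (e : R) : set_inj (linfty R G) (rho f) -> 0 < e ->
  exists2 h, abs_summable h & norm1 (delta 1%g - h ** f) < e.
Proof.
move=> rho_inj e0; apply: contrapT => no_h.
have d1 := abs_summable_point_mass R (1%g : G).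
have dist_gt0 : 0 < dist (delta 1%g).
  apply: (lt_le_trans e0); apply: le_dist => h hs; rewrite leNgt.
  by apply/negP => he; apply: no_h; exists h.
have [Phi [PhiD PhiZ Phi_le Phi1]] := seminorm_dominates_functional
  (@abs_summableD R G) (@abs_summableZ R G) distD distZ d1 dist_gt0.
pose g x := Phi (delta x).
have Phi_norm a : abs_summable a -> normc (Phi a) <= 2 * norm1 a.
  by move=> as_; apply: le_trans (Phi_le _ as_) _; rewrite ler_pM2l// dist_le_norm1.
have g2 : bounded_by g 2.
  move=> x; apply: le_trans (Phi_norm _ (abs_summable_point_mass R x)) _.
  by rewrite ler_piMr// norm1_le//; exact: abs_bounded_point_mass.
have rho_g : rho f g = rho f 0.
  apply/funext => x; transitivity (0 : R[i]); last first.
    by rewrite -(mul0r (csum f)) -csumZ.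
  have xs := abs_summable_point_mass R x.
  have xfs := abs_summable_convolution xs fs.
  (* By the representation of [Phi], [rho f g x] is the value of [Phi] at a left translate of [f],
     an element of the ideal. *)
  transitivity (Phi (delta x ** f)).
    rewrite -(csum_representation PhiD PhiZ Phi_norm)//.
    rewrite -(csum_reindex (phi := fun y => (x * y)%g) (mulgI x)
      (psi := fun z => (x^-1 * z)%g)).
    - rewrite rhoE; congr csum; apply/funext => y /=.
      by rewrite convolution_deltal mulKg mulrC.
    - under eq_fun do rewrite mulrC.
      exact: abs_summableM g2 xfs.
    - by move=> z; rewrite mulVKg.
  apply: eq0_normc; apply/eqP; rewrite eq_le normc_ge0 andbT.
  apply: le_trans (Phi_le _ xfs) _; rewrite pmulr_rle0//.
  by apply: le_trans (dist_le xfs xs) _; rewrite subrr.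
have : g = 0.
  apply: rho_inj rho_g; apply/mem_set/linftyP; first by exists 2.
  by exists 0 => x; rewrite normc0.
by move=> /(congr1 (fun u => u 1%g)).
Qed.

End LeftInverse.

(** * Neumann series *)

Section Neumann.
Variables (R : realType) (G : groupType).
Implicit Types (a f h u v : G -> R[i]).

Local Notation delta := (point_mass R).

(** The shift is [csum_comp] along [succn], whose image misses only 0, where [b] is set to zero. *)
Lemma csum_nat_recl (a : nat -> R[i]) : abs_summable a ->
  csum a = a 0%N + csum (fun n => a n.+1).
Proof.
move=> as_; pose b n := if n is 0%N then 0 else a n.
have bs : abs_summable b.
  apply: abs_summable_le as_ => -[|n]; last exact: lexx.
  by rewrite [leLHS]normc0 normc_ge0.
rewrite (_ : (fun n => a n.+1) = b \o succn)// csum_comp//; first last.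
- by move=> [//|n] /(_ n).
- exact: succn_inj.
have ms := abs_summable_point_mass R 0%N.
rewrite -(csum_point_mass 0%N a) -csumD//.
  congr csum; apply/funext => -[|n]; rewrite fctE point_massE/=.
    by rewrite addr0 mulr1.
  by rewrite mulr0 add0r.
by apply: abs_summableM ms => n; exact: normc_le_norm1.
Qed.

Lemma geometric_bounded : abs_bounded (fun n => ((2^-1 : R) ^+ n)%:C) 2.
Proof.
move=> A; under eq_bigr do rewrite normcR ger0_norm ?exprn_ge0//.
pose N := (\max_(n <- A) n).+1.
apply: (@le_trans _ _ (\sum_(0 <= n < N) (2^-1 : R) ^+ n)).
  rewrite -lee_fin -!sumEFin; apply: (@lee_sum_fset_nat _ _ A N xpredT).
    by move=> n _; rewrite lee_fin exprn_ge0.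
  move=> n nA; rewrite /= /N ltnS; exact: leq_bigmax_seq.
have -> : \sum_(0 <= n < N) (2^-1 : R) ^+ n = 2 - 2 * 2^-1 ^+ N.
  elim: N => [|N IH]; first by rewrite big_nil expr0; ring.
  by rewrite big_nat_recr//= IH exprS; field.
by rewrite gerBl mulr_ge0// exprn_ge0.
Qed.

Lemma neumann_left_inverse v : abs_summable v -> norm1 v <= 2^-1 ->
  exists2 w, abs_summable w & w ** (delta 1%g - v) = delta 1%g.
Proof.
move=> vs v2.
(* The Neumann series is the l1-combination sum_n 2^-n u^n of the powers of
   u = 2 v, which all have norm at most 1. *)
pose u := 2 *: v.
have us : abs_summable u by exact: abs_summableZ.
have u1 : norm1 u <= 1.
  apply: le_trans (norm1Z _ vs) _.
  rewrite (_ : normc 2 = 2); first by rewrite -ler_pdivlMl// mulr1.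
  by rewrite -(rmorph_nat (real_complex R)) normcR ger0_norm.
pose pow n := iter n (fun a => a ** u) (delta 1%g).
have pow1 n : abs_bounded (pow n) 1.
  elim: n => [|n IH]; first exact: abs_bounded_point_mass.
  have ns : abs_summable (pow n) by exists 1.
  move=> A; apply: le_trans (abs_bounded_convolution ns us A) _.
  by rewrite mulr_ile1 ?norm1_ge0// norm1_le.
have pows n : abs_summable (pow n) by exists 1.
pose s n : R[i] := ((2^-1 : R) ^+ n)%:C.
have ss : abs_summable s by exists 2; exact: geometric_bounded.
pose w := kernel_op (fun x n => pow n x) s.
have ws : abs_summable w by apply: (kernel_op_sum ler01 pow1).
(* Multiplication by [v] shifts the series by one index, because [pow n.+1 = 2 *: (pow n ** v)]
   while [s n = 2 * s n.+1]. Hence [w - w ** v] leaves only the term of index 0, the unit. *)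
have wv z : (w ** v) z = csum (fun n => pow n.+1 z * s n.+1).
  rewrite convolutionE /kernel_op; under eq_fun do rewrite mulrC.
  have zpow n : abs_bounded (fun y => pow n (z * y^-1)%g) 1.
    move=> A; apply: le_trans (abs_bounded_comp _ (pows n) A) (norm1_le (pow1 n)).
    by move=> y y' /mulgI/invg_inj.
  rewrite (csum_kernel (K := fun y n => pow n (z * y^-1)%g) ler01 zpow (b := v)
    (N := norm1 v))//.
    congr csum; apply/funext => n; rewrite mulrC.
    have -> : csum (fun y => v y * pow n (z * y^-1)%g) = (pow n ** v) z.
      by congr csum; apply/funext => y; rewrite mulrC.
    have -> : pow n.+1 = 2 *: (pow n ** v) by rewrite /= -convolutionZr.
    have -> x : (2 *: (pow n ** v)) z * x = (pow n ** v) z * (2 * x).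
      by rewrite mulrCA mulrA.
    congr (_ * _); rewrite /s exprS -(rmorph_nat (real_complex R)) -rmorphM.
    by rewrite mulVKf.
  by move=> y; exact: normc_le_norm1.
exists w => //; rewrite convolutionBr// ?convolution1r; last exact: abs_summable_point_mass.
apply/funext => z; transitivity (w z - (w ** v) z) => //.
rewrite wv {1}/w /kernel_op csum_nat_recl.
  by rewrite addrK /s expr0 mulr1.
exact: (kernel_op_summable pow1).
Qed.

Lemma rho_injective_left_inverse f : abs_summable f ->
  set_inj (linfty R G) (rho f) ->
  exists2 h, abs_summable h & h ** f = delta 1%g.
Proof.
move=> fs rho_inj.
have half_gt0 : 0 < (2^-1 : R) by rewrite invr_gt0.
have [h hs h2] := rho_injective_dense fs rho_inj half_gt0.
have hfs := abs_summable_convolution hs fs.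
have d1 := abs_summable_point_mass R (1%g : G).
have [w ws] := neumann_left_inverse (abs_summableB d1 hfs) (ltW h2).
rewrite opprB addrC subrK convolutionA// => whf.
by exists (w ** h) => //; exact: abs_summable_convolution.
Qed.

End Neumann.

(** * Direct finiteness *)

Section InnerProduct.
Variables (R : realType) (I : choiceType).
Implicit Types (a b c u v : I -> R[i]).

Lemma csum_conj a : abs_summable a -> csum (fun x => conjc (a x)) = conjc (csum a).
Proof.
move=> /csumP as_; apply: has_sum_csum => e /as_[A aA]; exists A => B /aA.
by rewrite -normc_conj rmorphB rmorph_sum.
Qed.

Definition inner a b := csum (fun x => a x * conjc (b x)).

(** The squared l2 norm, taken through [norm1] so as to land in [R]; see [inner_normsq]. *)
Definition normsq a : R := norm1 (fun x => a x * conjc (a x)).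

Lemma inner_summable a b : abs_summable a -> abs_summable b ->
  abs_summable (fun x => a x * conjc (b x)).
Proof.
move=> as_ bs; under eq_fun do rewrite mulrC.
by apply: abs_summableM as_ => x; rewrite normc_conj; exact: normc_le_norm1.
Qed.

Lemma innerDl a b c : abs_summable a -> abs_summable b -> abs_summable c ->
  inner (a + b) c = inner a c + inner b c.
Proof.
move=> as_ bs cs; rewrite /inner -csumD; [|exact: inner_summable..].
by congr csum; apply/funext => x; rewrite !fctE mulrDl.
Qed.

Lemma innerZl (k : R[i]) a b : abs_summable a -> abs_summable b ->
  inner (k *: a) b = k * inner a b.
Proof.
move=> as_ bs; rewrite /inner -csumZ; last exact: inner_summable.
by congr csum; apply/funext => x; exact: esym (mulrA _ _ _).
Qed.

Lemma innerC a b : abs_summable a -> abs_summable b -> inner b a = conjc (inner a b).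
Proof.
move=> as_ bs; rewrite /inner -csum_conj; last exact: inner_summable.
by congr csum; apply/funext => x; rewrite rmorphM/= conjcK mulrC.
Qed.

Lemma innerBl a b c : abs_summable a -> abs_summable b -> abs_summable c ->
  inner (a - b) c = inner a c - inner b c.
Proof.
move=> as_ bs cs; rewrite -scaleN1r innerDl//; last exact: abs_summableZ.
by rewrite innerZl// mulN1r.
Qed.

Lemma innerBr a b c : abs_summable a -> abs_summable b -> abs_summable c ->
  inner c (a - b) = inner c a - inner c b.
Proof.
move=> as_ bs cs; rewrite innerC ?innerBl//; last exact: abs_summableB.
by rewrite rmorphB/= -!innerC.
Qed.

Lemma innerZr (k : R[i]) a b : abs_summable a -> abs_summable b ->
  inner b (k *: a) = conjc k * inner b a.
Proof.
move=> as_ bs; rewrite innerC ?innerZl//; last exact: abs_summableZ.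
by rewrite rmorphM/= -innerC.
Qed.

Lemma inner_normsq a : abs_summable a -> inner a a = (normsq a)%:C.
Proof.
move=> as_; rewrite -(has_sum_csum (has_sum_norm1 (inner_summable as_ as_))).
congr csum; apply/funext => x.
by rewrite normcM normc_conj mulc_conj rmorphM expr2.
Qed.

Lemma normsq_ge0 a : abs_summable a -> 0 <= normsq a.
Proof. by move=> as_; exact/norm1_ge0/inner_summable. Qed.

Lemma sqr_normc_le_normsq a x : abs_summable a -> normc (a x) ^+ 2 <= normsq a.
Proof.
move=> as_; have := normc_le_norm1 x (inner_summable as_ as_).
by rewrite normcM normc_conj -expr2.
Qed.

Lemma normsq_norm1 a : abs_summable a -> normsq a <= norm1 a ^+ 2.
Proof.
move=> as_; apply: norm1_le; rewrite expr2.
apply: abs_boundedM (norm1_ge0 as_) _ _ => [x|A]; first exact: normc_le_norm1.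
by under eq_bigr do rewrite normc_conj; exact: norm1_ub.
Qed.

Lemma normc_inner a b (M : R) : 0 <= M -> abs_summable a ->
  (forall x, normc (b x) <= M) -> normc (inner a b) <= M * norm1 a.
Proof.
move=> M0 as_ bM.
have ab : abs_bounded (fun x => a x * conjc (b x)) (M * norm1 a).
  under eq_fun do rewrite mulrC.
  apply: abs_boundedM => //; last exact: abs_bounded_norm1.
  by move=> x; rewrite normc_conj.
by apply: le_trans (normc_csum _) (norm1_le ab); eexists; exact: ab.
Qed.

Lemma normsqBZ (k : R[i]) a b : abs_summable a -> abs_summable b ->
  inner (a - k *: b) (a - k *: b) =
  inner a a - k * inner b a - conjc k * conjc (inner b a) + k * conjc k * inner b b.
Proof.
move=> as_ bs; have kbs := abs_summableZ k bs; have abs := abs_summableB as_ kbs.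
rewrite innerBl// !innerBr// !innerZl// !innerZr// (innerC bs as_); ring.
Qed.

(** The parallelogram law, with the term of [a + b] dropped. *)
Lemma normsqB_le a b : abs_summable a -> abs_summable b ->
  normsq (a - b) <= 2 * normsq a + 2 * normsq b.
Proof.
move=> as_ bs.
have ms := normsqBZ 1 as_ bs; have ps := normsqBZ (-1) as_ bs.
have := normsq_ge0 (abs_summableB as_ (abs_summableZ (-1) bs)).
have abs := abs_summableB as_ (abs_summableZ (-1) bs).
move: ms ps; rewrite !scale1r !rmorphN !rmorph1 !inner_normsq//; last exact: abs_summableB.
move=> ms ps pos.
have : (normsq (a - b))%:C + (normsq (a - -1 *: b))%:C =
    (2 * normsq a + 2 * normsq b)%:C.
  by rewrite ms ps rmorphD !rmorphM !rmorph_nat; ring.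
by rewrite -rmorphD => /complexI <-; rewrite lerDl.
Qed.

End InnerProduct.

(** * Approximate orthogonal projection *)

Section NearOrthogonal.
Variables (R : realType) (I : choiceType) (P : set (I -> R[i])).
Hypothesis Ps : forall v, P v -> abs_summable v.
Hypothesis PBZ : forall (k : R[i]) u v, P u -> P v -> P (u - k *: v).
Hypothesis P0 : P 0.

(** Since l1 is not complete for the l2 norm, the distance from [b] to [P] may not be attained; [a]
    comes within [s ^+ 2] of the infimum of the squared distances. Moving [a] along [v] cannot gain
    more than [s ^+ 2], which bounds the inner product. *)
Lemma near_orthogonal_projection (b : I -> R[i]) (s : R) : abs_summable b -> 0 < s ->
  exists a, [/\ P a, normsq (b - a) <= normsq b + s ^+ 2 &
    forall v (N : R), P v -> 0 < N -> normsq v <= N ^+ 2 ->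
      normc (inner v (b - a)) <= s * N].
Proof.
move=> bs s0; pose E := [set normsq (b - a) | a in P].
have lbE : has_lbound E.
  by exists 0 => _ [a Pa <-]; apply/normsq_ge0/abs_summableB => //; exact: Ps.
have infE : has_inf E by split => //; exists (normsq (b - 0)), 0.
have s20 : 0 < s ^+ 2 by rewrite exprn_gt0.
have [_ [a Pa <-] a_near] := inf_adherent s20 infE; exists a; split => //.
  apply: le_trans (ltW a_near) _; rewrite lerD2r.
  by apply: ge_inf => //; exists 0 => //; rewrite subr0.
move=> v N Pv N0 vN; have vs := Ps Pv; have bas := abs_summableB bs (Ps Pa).
(* The best step along [v] is the conjugate of [c] over [normsq v]; with the bound [N ^+ 2] in the
   denominator the gain is still at least [r * normc c ^+ 2]. *)
set c := inner v (b - a); pose r := N ^- 2.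
have N20 : 0 < N ^+ 2 by rewrite exprn_gt0.
pose k := r%:C * conjc c.
have kconj : conjc k = r%:C * c by rewrite /k rmorphM/= oppr0 conjcK.
have Pstep : P (a - (- k) *: v) by exact: PBZ.
have := normsqBZ k bas vs.
have kE : b - a - k *: v = b - (a - (- k) *: v).
  by rewrite scaleNr opprK opprD addrA.
rewrite kE inner_normsq; last by apply: abs_summableB => //; exact: Ps.
rewrite !inner_normsq// -/c kconj /k.
have cc : conjc c * c = ((normc c) ^+ 2)%:C by rewrite mulrC mulc_conj rmorphXn.
have -> : (normsq (b - a))%:C - r%:C * conjc c * c - r%:C * c * conjc c +
    r%:C * conjc c * (r%:C * c) * (normsq v)%:C =
    (normsq (b - a) - 2 * r * normc c ^+ 2 + r ^+ 2 * normc c ^+ 2 * normsq v)%:C.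
  move: cc; move: (normc c ^+ 2) => C2 cc.
  by rewrite rmorphD rmorphB !rmorphM rmorph_nat/= -cc; ring.
move=> /complexI nE.
have : inf E <= normsq (b - (a - (- k) *: v)) by apply: ge_inf => //; exists (a - (- k) *: v).
rewrite nE => low.
have rN : r * N ^+ 2 = 1 by rewrite mulVf// gt_eqF.
have r0 : 0 < r by rewrite invr_gt0.
have : r ^+ 2 * normc c ^+ 2 * normsq v <= r * normc c ^+ 2.
  rewrite -[leRHS]mul1r -rN [leLHS](_ : _ = (r * normsq v) * (r * normc c ^+ 2)); last by ring.
  by rewrite ler_wpM2r ?mulr_ge0 ?exprn_ge0 ?normc_ge0 ?(ltW r0)// ler_pM2l.
move=> quad; have : r * normc c ^+ 2 <= s ^+ 2 by lra.
rewrite mulrC ler_pdivrMr// -exprMn ler_pXn2r// nnegrE ?normc_ge0//.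
by rewrite mulr_ge0// ltW.
Qed.

End NearOrthogonal.

(** * Idempotents of trace zero *)

Section DirectFiniteness.
Variables (R : realType) (G : groupType).
Implicit Types (a f h q u v : G -> R[i]).

Local Notation delta := (point_mass R).

Lemma abs_summable_right_translate a x : abs_summable a ->
  abs_summable (a ** delta x).
Proof. by move=> as_; exact/abs_summable_convolution/abs_summable_point_mass. Qed.

Lemma inner_right_translate a b x : abs_summable a -> abs_summable b ->
  inner (a ** delta x) (b ** delta x) = inner a b.
Proof.
move=> as_ bs; rewrite /inner.
under eq_fun do rewrite !convolution_deltar.
rewrite (csum_reindex (phi := fun z => (z * x^-1)%g) (mulIg _)
  (psi := fun z => (z * x)%g)
  (inner_summable as_ bs))//.
by move=> z; rewrite mulgK.
Qed.

Lemma normsq_right_translate a x : abs_summable a ->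
  normsq (a ** delta x) = normsq a.
Proof.
move=> as_; apply: complexI; rewrite -!inner_normsq//.
  exact: inner_right_translate.
exact: abs_summable_right_translate.
Qed.

Lemma right_translateVK a x : (a ** delta x^-1%g) ** delta x = a.
Proof. by apply/funext => z; rewrite !convolution_deltar invgK mulgVK. Qed.

Lemma norm1_right_translate a x : abs_summable a -> norm1 (a ** delta x) <= norm1 a.
Proof.
move=> as_; apply: le_trans (norm1_convolution as_ (abs_summable_point_mass R x)) _.
by rewrite ler_piMr ?norm1_ge0// norm1_le//; exact: abs_bounded_point_mass.
Qed.

(** Evaluation at the identity is a trace: substitute the inverse of the summation variable. *)
Lemma convolution_trace f h : abs_summable h -> abs_summable f ->
  (f ** h) 1%g = (h ** f) 1%g.
Proof.
move=> hs fs.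
rewrite -[RHS](csum_reindex (phi := fun y : G => y^-1%g) invg_inj
  (psi := fun y : G => y^-1%g) (convolution_summable 1%g hs fs)).
  by congr csum; apply/funext => y /=; rewrite !mul1g invgK mulrC.
exact: invgK.
Qed.

Lemma idempotent_trace0 q : abs_summable q -> q ** q = q -> q 1%g = 0 -> q = 0.
Proof.
move=> qs qq q1.
pose P := [set v | abs_summable v /\ q ** v = v].
have PBZ (k : R[i]) u v : P u -> P v -> P (u - k *: v).
  move=> [us qu] [vs qv]; have kvs := abs_summableZ k vs.
  by split; [exact: abs_summableB|rewrite convolutionBr// convolutionZr// qu qv].
have P0 : P 0.
  have Pq : P q by [].
  by have := PBZ 1 q q Pq Pq; rewrite scale1r subrr.
have Pdelta v x : P v -> P (v ** delta x).
  move=> [vs qv]; split; first exact: abs_summable_right_translate.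
  by rewrite convolutionA ?qv//; exact: abs_summable_point_mass.
have ds : abs_summable (delta (1%g : G)) by exact: abs_summable_point_mass.
(* [N] bounds both the l1 and the l2 norm of [q]; since [1 <= N], lower powers of [N] can be
   absorbed into higher ones. *)
pose N := norm1 q + 1.
have N1 : 1 <= N by rewrite lerDr norm1_ge0.
have qN : norm1 q <= N by rewrite lerDl.
have qN2 : normsq q <= N ^+ 2.
  apply: le_trans (normsq_norm1 qs) _.
  by rewrite ler_pXn2r// ?nnegrE ?norm1_ge0//; lra.
have q_small x (t : R) : 0 < t -> t <= 1 -> normc (q x) <= 5 * t * N ^+ 2.
  (* The error [s] of the projection will bound [normsq a] up to a constant, so the values of [a]
     are of the order of its square root [t]. *)
  move=> t0 t1; pose s := t ^+ 2.
  have s0 : 0 < s by rewrite exprn_gt0.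
  have s1 : s <= t by rewrite /s expr2 ler_piMl// ltW.
  have [a [Pa da orth]] := near_orthogonal_projection (fun v => @proj1 _ _) PBZ P0 ds s0.
  have [as_ qa] := Pa.
  have normsq_delta : normsq (delta (1%g : G)) <= 1.
    apply: le_trans (normsq_norm1 ds) _; rewrite exprn_ile1 ?norm1_ge0//.
    by apply: norm1_le; exact: abs_bounded_point_mass.
  (* As [a] is [delta 1%g] minus their difference, [normsq a <= 2 * 1 + 2 * 2]; the square 9 leaves
     room and gives the norm bound 3. *)
  have a9 : normsq a <= 3 ^+ 2.
    have := normsqB_le ds (abs_summableB ds as_).
    rewrite opprB addrC subrK; nra.
  have orthE v (M : R) : P v -> 0 < M -> normsq v <= M ^+ 2 ->
      normc (v 1%g - inner v a) <= s * M.
    move=> Pv M0 vM; have := orth v M Pv M0 vM.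
    rewrite innerBr//; last by case: Pv.
    rewrite [X in normc (X - _)](_ : _ = v 1%g)// -[RHS](csum_point_mass 1%g v).
    by congr csum; apply/funext => x'; rewrite point_massE conjc_nat.
  have a1 := orthE a 3 Pa (ltr0Sn _ _) a9.
  have q_orth : normc (inner q a) <= s * N.
    have := orthE q N (conj qs qq) (lt_le_trans ltr01 N1) qN2.
    by rewrite q1 sub0r normc_opp.
  (* Both [a y^-1] and the conjugate of [a y] are within [3 * s] of [inner (a ** delta y) a]: the
     first by [orthE], the second because right translation is unitary. *)
  have a_selfadj y : normc (a y^-1%g - conjc (a y)) <= 6 * s.
    have corr z : normc (a z^-1%g - inner (a ** delta z) a) <= s * 3.
      have := orthE (a ** delta z) 3 (Pdelta a z Pa) (ltr0Sn _ _).
      by rewrite normsq_right_translate// convolution_deltar mul1g; exact.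
    have := corr y^-1%g; rewrite invgK -normc_conj rmorphB/= => corr_inv.
    have conj_inner : conjc (inner (a ** delta y^-1%g) a) = inner (a ** delta y) a.
      rewrite -innerC//; last exact: abs_summable_right_translate.
      rewrite -(inner_right_translate y)//; last exact: abs_summable_right_translate.
      by rewrite right_translateVK.
    rewrite conj_inner in corr_inv.
    have := normcB (a y^-1%g - inner (a ** delta y) a)
      (conjc (a y) - inner (a ** delta y) a).
    rewrite opprB addrA subrK; have := corr y; lra.
  have a1_small : normc (a 1%g) <= 7 * s * N.
    (* The trace property turns [a 1 = (q ** a) 1] into the sum of [a y^-1 * q y]; replacing
       [a y^-1] by the conjugate of [a y] produces [inner q a]. *)
    have qa_trace : normc (a 1%g - inner q a) <= 6 * s * norm1 q.
      have s6 : 0 <= 6 * s by lra.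
      pose d y := a y^-1%g - conjc (a y).
      have dq := abs_boundedM s6 a_selfadj (abs_bounded_norm1 qs).
      have -> : a 1%g - inner q a = csum (fun y => d y * q y).
        rewrite -{1}qa convolution_trace// -csumB; last exact: inner_summable.
          congr csum; apply/funext => y; rewrite fctE mul1g.
          by rewrite mulrBl; congr (_ - _); exact: mulrC.
        exact: convolution_summable.
      by apply: le_trans (normc_csum _) (norm1_le dq); eexists; exact: dq.
    have := normcD (a 1%g - inner q a) (inner q a); rewrite subrK.
    nra.
  (* Here [normsq a <= 7 * s * N + 3 * s <= 16 * s * N ^+ 2]. *)
  have a_normsq : normsq a <= (4 * t * N) ^+ 2.
    have := normcB (a 1%g) (a 1%g - inner a a).
    rewrite opprB addrC subrK inner_normsq// normcR ger0_norm ?normsq_ge0//.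
    move: a1; rewrite inner_normsq//.
    have := ler_wpM2l (ltW s0) N1; have : (4 * t * N) ^+ 2 = 16 * s * N ^+ 2 by rewrite /s; ring.
    nra.
  have a_le y : normc (a y) <= 4 * t * N.
    rewrite -(@ler_pXn2r _ 2)// ?nnegrE ?normc_ge0//; last by rewrite !mulr_ge0//; lra.
    exact: le_trans (sqr_normc_le_normsq y as_) a_normsq.
  (* The translate of [q] takes the value [q x] at the identity, so [q x] is within [s * N] of an
     inner product with the small function [a]. *)
  have Pqx := Pdelta q x^-1%g (conj qs qq).
  have := orthE _ N Pqx (lt_le_trans ltr01 N1).
  rewrite normsq_right_translate// convolution_deltar invgK mul1g => /(_ qN2) qx.
  have tN0 : 0 <= 4 * t * N by rewrite !mulr_ge0//; lra.
  have := normc_inner tN0 Pqx.1 a_le.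
  have := ler_wpM2l tN0 (le_trans (norm1_right_translate x^-1%g qs) qN).
  have := normcD (q x - inner (q ** delta x^-1%g) a) (inner (q ** delta x^-1%g) a).
  rewrite subrK.
  have sN : s * N <= t * N ^+ 2.
    have tN : t <= t * N by rewrite ler_peMr// ltW.
    by rewrite expr2 mulrA; apply: ler_pM => //; lra.
  have -> : 4 * t * N * N = 4 * (t * N ^+ 2) by ring.
  have -> : 5 * t * N ^+ 2 = 5 * (t * N ^+ 2) by ring.
  lra.
apply/funext => x; apply: eq0_normc; apply/eqP; rewrite eq_le normc_ge0 andbT.
rewrite leNgt; apply/negP => m0; set m := normc (q x) in m0.
have N20 : 0 < N ^+ 2 by rewrite exprn_gt0//; lra.
have mN0 : 0 < m + 10 * N ^+ 2 by lra.
(* Chosen so that [t <= 1] and [10 * t * N ^+ 2 = m - t * m < m], against [m <= 5 * t * N ^+ 2]. *)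
pose t := m / (m + 10 * N ^+ 2).
have t0 : 0 < t by rewrite divr_gt0.
have tE : t * (m + 10 * N ^+ 2) = m by rewrite divfK// gt_eqF.
have t1 : t <= 1 by rewrite ler_pdivrMr// mul1r lerDl; lra.
have := q_small x t t0 t1; rewrite -/m -mulrA.
have := mulr_gt0 t0 m0; rewrite mulrDr in tE.
have := mulrCA t 10 (N ^+ 2); lra.
Qed.

Lemma convolution_inverse_comm f h : abs_summable f -> abs_summable h ->
  h ** f = delta 1%g -> f ** h = delta 1%g.
Proof.
move=> fs hs hf; have ds := abs_summable_point_mass R (1%g : G).
have fhs := abs_summable_convolution fs hs.
have fhfh : (f ** h) ** (f ** h) = f ** h.
  by rewrite convolutionA// -(convolutionA fs hs fs) hf convolution1r.
apply/eqP; rewrite eq_sym -subr_eq0; apply/eqP/idempotent_trace0.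
- exact: abs_summableB.
- rewrite convolutionBl//; last exact: abs_summableB.
  by rewrite !convolutionBr// !convolution1l convolution1r fhfh subrr subr0.
- transitivity (delta (1%g : G) 1%g - (f ** h) 1%g) => //.
  by rewrite convolution_trace// hf subrr.
Qed.

End DirectFiniteness.

(** * The equivalence *)

Section Equivalence.
Variables (R : realType) (G : groupType) (f : G -> R[i]).
Hypothesis fs : abs_summable f.

Local Notation delta := (point_mass R).

Lemma rho_linfty u : linfty R G u -> linfty R G (rho f u).
Proof.
move=> /linftyP[M uM]; apply/linftyP; exists (`|M| * norm1 f).
by apply: bounded_by_rho => // x; exact: le_trans (uM x) (ler_norm M).
Qed.

Lemma rho_injective_inverse : set_inj (linfty R G) (rho f) ->
  exists2 h, abs_summable h & f ** h = delta 1%g /\ h ** f = delta 1%g.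
Proof.
move=> /(rho_injective_left_inverse fs)[h hs hf]; exists h => //.
by split => //; exact: convolution_inverse_comm.
Qed.

Lemma rhoK g u : abs_summable g -> g ** f = delta 1%g -> linfty R G u ->
  rho g (rho f u) = u.
Proof.
by move=> gs gf /linftyP[M uM]; rewrite (rho_convolution gs fs uM) gf rho_delta.
Qed.

End Equivalence.

Theorem theorem1 (R : realType) (Gamma : groupType) (f : Gamma -> R[i]%C)
    (f_l1 : l1 f) :
  [<-> set_inj (linfty R Gamma) (rho f);
       set_bij (linfty R Gamma) (linfty R Gamma) (rho f);
       exists2 g : Gamma -> R[i]%C, l1 g &
         convolution f g = delta_e R Gamma /\ convolution g f = delta_e R Gamma].
Proof.
have fs : abs_summable f by exact/l1P.
tfae.
- move=> rho_inj; split => //.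
    by move=> u; exact: rho_linfty.
  have [h hs [fh _]] := rho_injective_inverse fs rho_inj.
  move=> u uoo; exists (rho h u); first exact: rho_linfty.
  (* Here [rhoK] is used with [f] and [h] exchanged, through [f ** h = delta 1%g]. *)
  exact: rhoK.
- move=> [_ rho_inj _]; have [h hs fhf] := rho_injective_inverse fs rho_inj.
  by exists h => //; exact/l1P.
(* The equation [g ** f = delta_e] makes [rho g] a left inverse of [rho f] on bounded functions. *)
- move=> [g /l1P gs [_ gf]] u v /set_mem uoo /set_mem voo uv.
  by rewrite -(rhoK fs gs gf uoo) uv rhoK.
Qed.
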